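(* There is an algorithm that, given a finite directed graph $D$ on $n$ vertices, computes the minimum size of a set $S\subseteq V(D)$ such that $D-S$ is knot-free (i.e. solves the Knot-Free Vertex Deletion problem), and runs in time $\mathcal{O}^*(1.4549^n)$.
   Context: All digraphs are finite, without loops or parallel arcs. A knot in a digraph $D$ is a strongly connected component $K$ with $|V(K)|\ge 2$ such that there is no arc $(u,v)$ with $u\in V(K)$ and $v\notin V(K)$. $D$ is knot-free if it contains no knot. For $S\subseteq V(D)$, $D-S$ is the subgraph induced on $V(D)\setminus S$. The Knot-Free Vertex Deletion problem asks, given $D$, for the minimum size of $S\subseteq V(D)$ with $D-S$ knot-free. $\mathcal{O}^*(\cdot)$ suppresses factors polynomial in $n$. *)

(* Defs.v *)
From mathcomp Require Import all_boot all_order all_algebra.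

Set Implicit Arguments.
Unset Strict Implicit.
Unset Printing Implicit Defensive.

Import GRing.Theory Num.Theory.

Record digraph (V : finType) := Digraph {
  arc :> rel V;
  arc_irrefl : irreflexive arc
}.

Section Digraphs.
Variable V : finType.
Implicit Types (D : digraph V) (S K : {set V}).

Definition mutually_reachable D : rel V :=
  [rel u v | connect D u v && connect D v u].

Definition scc D : {set {set V}} :=
  equivalence_partition (mutually_reachable D) [set: V].

Definition knot D K : bool :=
  [&& K \in scc D, 2 <= #|K|
    & [forall u in K, forall v, (v \notin K) ==> ~~ D u v]].

Definition knot_free D : Prop := forall K, ~~ knot D K.

End Digraphs.

Section Deletion.
Variables (V : finType) (D : digraph V).

Definition delete_arc (S : {set V}) : rel {v : V | v \notin S} :=
  [rel u v | D (val u) (val v)].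

Lemma delete_arc_irrefl (S : {set V}) : irreflexive (delete_arc (S := S)).
Proof. by move=> u; apply: arc_irrefl. Qed.

Definition delete (S : {set V}) : digraph {v : V | v \notin S} :=
  Digraph (delete_arc_irrefl (S := S)).

Definition kfvd_optimum (k : nat) : Prop :=
  (exists2 S : {set V}, knot_free (delete S) & #|S| = k) /\
  (forall S : {set V}, knot_free (delete S) -> k <= #|S|).

End Deletion.

(** A program is a finite list of unary functions, written in a first-order
    call-by-value language over binary trees (as in N. Jones, "Computability
    and Complexity from a Programming Perspective").  Every elementary step
    costs one unit: reading a variable, allocating one cell, one case
    distinction, one binding, one call.  With trees stored as pointers into a
    heap, each step takes a constant number of operations of a random access
    machine whose words can address that heap.  Conversely, a memory of N
    words of b bits is a balanced tree with access time O(log N + b); for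
    running times that are at most exponential in n these factors are
    polynomial in n, so the O* classes of the two models coincide. *)

Inductive tree := Leaf | Node of tree & tree.

(** Variables are de Bruijn indices.  [Case e e0 e1] evaluates [e0] if [e] is
    a leaf, and otherwise [e1] with index 0 bound to the left subtree and
    index 1 to the right subtree.  [Call f e] calls the [f]-th function of the
    program, whose body sees only its argument. *)
Inductive expr :=
  | Var of nat
  | Nil
  | Cons of expr & expr
  | Let of expr & expr
  | Case of expr & expr & expr
  | Call of nat & expr.

Definition program := seq expr.

(** [eval P env e v t]: in the environment [env], [e] evaluates to [v] in
    exactly [t] steps. *)
Inductive eval (P : program) : seq tree -> expr -> tree -> nat -> Prop :=
  | EvalVar env i : eval P env (Var i) (nth Leaf env i) 1
  | EvalNil env : eval P env Nil Leaf 1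
  | EvalCons env e1 e2 v1 v2 t1 t2 :
      eval P env e1 v1 t1 -> eval P env e2 v2 t2 ->
      eval P env (Cons e1 e2) (Node v1 v2) (t1 + t2).+1
  | EvalLet env e1 e2 v1 v2 t1 t2 :
      eval P env e1 v1 t1 -> eval P (v1 :: env) e2 v2 t2 ->
      eval P env (Let e1 e2) v2 (t1 + t2).+1
  | EvalCaseLeaf env e e0 e1 v t t0 :
      eval P env e Leaf t -> eval P env e0 v t0 ->
      eval P env (Case e e0 e1) v (t + t0).+1
  | EvalCaseNode env e e0 e1 l r v t t1 :
      eval P env e (Node l r) t -> eval P (l :: r :: env) e1 v t1 ->
      eval P env (Case e e0 e1) v (t + t1).+1
  | EvalCall env f e v w t t' :
      eval P env e v t -> eval P [:: v] (nth Nil P f) w t' ->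
      eval P env (Call f e) w (t + t').+1.

(** Result and running time are unique, so [eval] exhibiting a value and a
    number of steps describes the run of the program. *)
Lemma eval_functional P env e v t v' t' :
  eval P env e v t -> eval P env e v' t' -> v = v' /\ t = t'.
Proof.
move=> ev; elim: ev v' t' => {env e v t} *;
  match goal with H : eval _ _ _ _ _ |- _ = _ /\ _ =>
    move: H; repeat match goal with K : eval _ _ _ _ _ |- _ => clear K end;
    move=> H; inversion H; subst; clear H
  end;
  repeat match goal with
  | IH : forall v t, eval ?P ?env ?e v t -> _, H : eval ?P ?env ?e _ _ |- _ =>
      case: (IH _ _ H) => {IH} ? ?; subst
  | H : Node _ _ = Node _ _ |- _ => case: H => ? ?; subst
  end; by [].
Qed.

Definition run (P : program) (x y : tree) (t : nat) : Prop :=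
  eval P [:: x] (nth Nil P 0) y t.

Definition tree_of_seq (s : seq tree) : tree := foldr Node Leaf s.
Definition tree_of_nat (n : nat) : tree := tree_of_seq (nseq n Leaf).
Definition tree_of_bool (b : bool) : tree := if b then Node Leaf Leaf else Leaf.

(** The adjacency matrix, as the list of its rows. *)
Definition tree_of_digraph (V : finType) (D : digraph V) : tree :=
  tree_of_seq [seq tree_of_seq [seq tree_of_bool (D u v) | v <- enum V]
              | u <- enum V].

Local Open Scope ring_scope.

(** T(n) = O*(c^n). *)
Definition Ostar (c : rat) (T : nat -> nat) : Prop :=
  exists p : {poly rat}, forall n : nat, (T n)%:R <= p.[n%:R] * c ^+ n.

Definition solves_kfvd_in_time (P : program) (T : nat -> nat) : Prop :=
  forall (V : finType) (D : digraph V),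
    exists k t : nat,
      [/\ kfvd_optimum D k,
          run P (tree_of_digraph D) (tree_of_nat k) t
        & (t <= T #|V|)%N].

(* Main.v *)
(** Write N(z) for the set of out-neighbours of z.  A minimum solution S of D[W]
    equals N(Z), where Z is the set of sinks of D[W] - S, since a deleted vertex
    that no sink points to could be restored.  For z in W let the cluster of z
    consist of N(z) and of the vertices that reach z in D[W] - N(z).  Every vertex
    of W then lies in the cluster of some z in Z, and choosing z as a sink costs
    |N(z)| and leaves an independent instance on the complement of the cluster.
    So for any fixed x in W,
      opt(W) = min { |N(z)| + opt(W minus cluster(z)) : x in cluster(z) }.
    Summing 1/|cluster(z)| over all pairs (x, z) with x in cluster(z) gives |W|, so
    some x satisfies sum_{z : x in cluster(z)} 1/|cluster(z)| <= 1.  Branching on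
    such an x produces at most 3^(n/3) leaves because k <= 3^(k/3) for all k; as
    3^(1/3) < 1.4549, there is room to replace 1/k by a rounded integer weight. *)

From Pilot Require Import Defs.
From mathcomp Require Import all_boot all_order all_algebra.
From mathcomp Require Import zify lra.
(* Gives [Nil] and [Cons] back to [expr]: MathComp uses these names for lists. *)
Import Pilot.Defs.

Set Implicit Arguments.
Unset Strict Implicit.
Unset Printing Implicit Defensive.

(** * Clusters and the branching recurrence *)

(** Among the vertices reachable from v, one that reaches the fewest vertices is reached back by all
    of them. They form a closed strong component, which is a knot unless that vertex is a sink.
    Conversely, a knot is closed, so it contains every sink reached from it, but strong connectivity
    gives such a vertex an out-arc. *)
Lemma knot_free_sinkP (T : finType) (H : digraph T) :
  knot_free H <->
  forall v, exists2 t, connect H v t & forall w, ~~ H t w.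
Proof.
have mutE u v : mutually_reachable H u v = connect H u v && connect H v u by [].
split=> [kf v|sinks K].
  have [t vt min_t] : exists2 t, connect H v t
      & forall u, connect H v u -> #|connect H t| <= #|connect H u|.
    have [t vt min_t] := arg_minnP (fun t => #|connect H t|) (connect0 H v).
    by exists t.
  exists t => // w; apply/negP => tw.
  have back u : connect H t u -> connect H u t.
    move=> tu; have sub : connect H u \subset connect H t.
      by apply/subsetP => y; apply: connect_trans.
    have /eqP eq_ut : #|connect H u| == #|connect H t|.
      rewrite eqn_leq subset_leq_card //=; apply: min_t.
      exact: connect_trans vt tu.
    by have /subset_cardP/(_ sub t) := eq_ut; rewrite !inE connect0.
  have /negP[] := kf [set u | mutually_reachable H t u].
  apply/and3P; split.
  - by apply/imsetP; exists t; rewrite ?inE //; apply/setP => u; rewrite !inE.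
  - have -> : 2 = #|[set t; w]|.
      by rewrite cards2; case: eqVneq tw => // ->; rewrite arc_irrefl.
    apply/subset_leq_card/subsetP => u; rewrite !inE.
    by rewrite mutE; case/orP=> /eqP->; rewrite ?connect0 // (back w) connect1.
  - apply/forall_inP => u; rewrite inE mutE => /andP[tu _]; apply/forallP => y.
    apply/implyP; rewrite inE; apply: contra => uy.
    have ty : connect H t y by apply: connect_trans tu (connect1 uy).
    by rewrite mutE ty back.
apply/negP => /and3P[/imsetP[x _ defK] K2 /forall_inP closedK].
have [t xt sink_t] := sinks x.
have closed u w : u \in K -> connect H u w -> w \in K.
  move=> Ku /connectP[p + ->]; elim: p u Ku => //= y p IHp u Ku.
  case/andP=> uy; apply: IHp; apply: contraTT uy => K'y.
  by have /forallP/(_ y)/implyP := closedK u Ku; apply.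
have Kx : x \in K by rewrite defK !inE mutE connect0.
have Kt := closed _ _ Kx xt.
have [w Kw w't] : exists2 w, w \in K & w != t.
  have /card_gt0P[w] : 0 < #|K :\ t| by move: K2; rewrite (cardsD1 t) Kt.
  by rewrite !inE => /andP[]; exists w.
have : connect H t w.
  move: Kw Kt; rewrite defK !inE !mutE /= => /andP[xw _] /andP[_ tx].
  exact: connect_trans tx xw.
case/connectP=> -[/= _ wt|y p /= /andP[ty _] _]; first by rewrite wt eqxx in w't.
by have := sink_t y; rewrite ty.
Qed.

Section Clusters.

Variables (V : finType) (D : digraph V).
Implicit Types (A B W S X : {set V}) (u v w x y z t : V).

(** Kept on the type [V] instead of a subtype, so that the recursion can change [A] freely. *)
Definition induced A : rel V := [rel u v | [&& u \in A, v \in A & D u v]].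

Lemma inducedE A u v : induced A u v = [&& u \in A, v \in A & D u v].
Proof. by []. Qed.

Definition sink_of A t := (t \in A) && [forall w in A, ~~ D t w].

(** By [knot_free_sinkP], this is a decidable form of the knot-freeness of D[A]. *)
Definition drains A :=
  [forall v in A, [exists t, sink_of A t && connect (induced A) v t]].

Lemma drainsP A :
  reflect (forall v, v \in A -> exists2 t, sink_of A t & connect (induced A) v t)
          (drains A).
Proof.
apply: (iffP forall_inP) => dr v /dr; first by case/existsP=> t /andP[]; exists t.
by case=> t ? ?; apply/existsP; exists t; apply/andP.
Qed.

Lemma sink_ofP A t :
  reflect (t \in A /\ forall w, w \in A -> ~~ D t w) (sink_of A t).
Proof. by apply: (iffP andP) => -[? /forall_inP]. Qed.

Lemma connect_inducedS A B u v :
  A \subset B -> connect (induced A) u v -> connect (induced B) u v.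
Proof.
move=> /subsetP sAB; apply: connect_sub => x y /and3P[Ax Ay xy].
by apply: connect1; rewrite inducedE !sAB.
Qed.

Lemma knot_free_delete S : knot_free (delete D S) <-> drains (~: S).
Proof.
have delE (a b : {v : V | v \notin S}) : delete D S a b = D (val a) (val b) by [].
have connE (a b : {v : V | v \notin S}) :
  connect (delete D S) a b = connect (induced (~: S)) (val a) (val b).
  apply/idP/idP.
    case/connectP=> p + ->; elim: p a => [|c p IHp] a /=; first by rewrite connect0.
    case/andP=> ac /IHp; apply: connect_trans; apply: connect1.
    by rewrite inducedE !inE (valP a) (valP c); apply: ac.
  case/connectP=> p; elim: p a => [|c p IHp] a /=.
    by move=> _ /val_inj ->; apply: connect0.
  case/andP=> /and3P[_ Sc ac] pp def_b; rewrite inE in Sc.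
  have : connect (delete D S) (Sub c Sc) b by apply: IHp; rewrite ?SubK.
  by apply: connect_trans; apply: connect1; rewrite delE SubK.
rewrite knot_free_sinkP; split=> [sinks|/drainsP dr v].
  apply/drainsP => v; rewrite inE => Sv; have [t] := sinks (Sub v Sv).
  rewrite connE SubK => vt sink_t; exists (val t) => //; apply/sink_ofP; split.
    by rewrite inE (valP t).
  by move=> w; rewrite inE => Sw; have := sink_t (Sub w Sw); rewrite delE SubK.
have [|t /sink_ofP[At sink_t] vt] := dr (val v); first by rewrite inE (valP v).
rewrite inE in At; exists (Sub t At) => [|w]; first by rewrite connE SubK.
by rewrite delE SubK; apply: sink_t; rewrite inE (valP w).
Qed.

Definition solves W S := (S \subset W) && drains (W :\: S).

(** The default [W] of the minimum is a solution by [solves_all], so the minimum is attained by a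
    genuine solution. *)
Definition opt W := #|[arg min_(S < W | solves W S) #|S|]|.

Lemma solves_all W : solves W W.
Proof. by rewrite /solves subxx setDv; apply/drainsP => v; rewrite inE. Qed.

Lemma opt_solution W : exists2 S, solves W S & #|S| = opt W.
Proof.
by rewrite /opt; case: (arg_minnP _ (solves_all W)) => S; exists S.
Qed.

Lemma opt_min W S : solves W S -> opt W <= #|S|.
Proof. by rewrite /opt; case: (arg_minnP _ (solves_all W)) => S' _; apply. Qed.

Lemma kfvd_optimum_opt : kfvd_optimum D (opt [set: V]).
Proof.
have solE S : solves [set: V] S <-> knot_free (delete D S).
  by rewrite knot_free_delete /solves subsetT setTD.
split=> [|S /solE/opt_min //].
by have [S /solE] := opt_solution [set: V]; exists S.
Qed.

Lemma opt0 : opt set0 = 0.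
Proof.
by apply/eqP; rewrite -leqn0 -(cards0 V); apply/opt_min/solves_all.
Qed.

Definition outs W z := [set y in W | D z y].

(** One round of the backward search from z in D[W] - N(z). The fixpoint form of [basin] mirrors the
    iteration carried out by the program. *)
Definition feeders W z X :=
  z |: [set y in W :\: outs W z | [exists r in X, D y r]].

Definition basin W z := fixset (feeders W z).

Definition cluster W z := outs W z :|: basin W z.

Lemma feeders_homo W z : {homo feeders W z : X Y / X \subset Y}.
Proof.
move=> X Y /subsetP sXY; apply: setUS; apply/subsetP => y; rewrite !inE.
by case/andP=> -> /exists_inP[r /sXY Yr yr]; apply/exists_inP; exists r.
Qed.

Lemma mem_outs_self W z : z \in outs W z = false.
Proof. by rewrite inE arc_irrefl andbF. Qed.

Lemma basinP W z y : z \in W ->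
  y \in basin W z =
  (y \in W :\: outs W z) && connect (induced (W :\: outs W z)) y z.
Proof.
move=> Wz; set A := W :\: outs W z; have Az : z \in A.
  by rewrite inE mem_outs_self.
apply/idP/andP => [|[Ay /connectP[p]]]; last first.
  (* Membership travels backwards along the path, one unfolding of the fixpoint per arc. *)
  elim: p y Ay => [|r p IHp] y Ay /=.
    by move=> _ <-; rewrite /basin -fixsetK ?inE ?eqxx //; apply: feeders_homo.
  case/andP=> /and3P[_ Ar yr] pp /(IHp r Ar pp) Br.
  rewrite /basin -fixsetK; last exact: feeders_homo.
  rewrite /feeders -/A in_setU1 inE Ay; apply/orP; right.
  by apply/exists_inP; exists r.
rewrite /basin /fixset; elim: #|V| y => [|n IHn] y; first by rewrite inE.
rewrite iterS /feeders -/A in_setU1 => /predU1P[->|]; first by rewrite connect0.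
rewrite inE => /andP[Ay /exists_inP[r /IHn[Ar rz] yr]]; split=> //.
by apply: connect_trans rz; apply: connect1; rewrite inducedE Ay Ar.
Qed.

Lemma basin_self W z : z \in basin W z.
Proof.
by rewrite /basin -fixsetK ?inE ?eqxx //; apply: feeders_homo.
Qed.

Lemma cluster_self W z : z \in cluster W z.
Proof. by rewrite inE basin_self orbT. Qed.

Lemma cluster_sub W z : z \in W -> cluster W z \subset W.
Proof.
move=> Wz; rewrite subUset; apply/andP; split; apply/subsetP => y.
  by rewrite inE => /andP[].
by rewrite basinP // inE => /andP[/andP[]].
Qed.

(** If v were in the basin, u would reach z through v and be in it too. Hence, once N(z) is deleted,
    no arc leads from the complement of the cluster back into it: the complement is an independent
    instance. *)
Lemma cluster_closed W z u v :
  z \in W -> u \in W :\: cluster W z -> v \in W -> D u v ->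
  v \in outs W z \/ v \in W :\: cluster W z.
Proof.
move=> Wz /setDP[Wu + Wv]; rewrite /cluster !in_setU !in_setD !in_setU !basinP //.
rewrite !in_setD Wu Wv !andbT /= => /norP[Nu Bu] uv.
have [Nv|Nv] := boolP (v \in outs W z); [by left | right].
apply: contra Bu => /= vz; rewrite Nu; apply: connect_trans vz; apply: connect1.
by rewrite inducedE !in_setD Nu Nv Wu Wv.
Qed.

(** N(z) together with a solution of the complement solves W: the basin drains into z, which has
    become a sink, and the sinks of the complement remain sinks by [cluster_closed]. *)
Lemma opt_le_cluster W z :
  z \in W -> opt W <= #|outs W z| + opt (W :\: cluster W z).
Proof.
move=> Wz; have [S /andP[sSQ drS] <-] := opt_solution (W :\: cluster W z).
apply: leq_trans (leq_card_setU _ _).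
have sQW : W :\: cluster W z \subset W by apply: subsetDl.
apply: opt_min; rewrite /solves subUset (subset_trans sSQ sQW) andbT.
have -> /= : outs W z \subset W by apply/subsetP => y; rewrite inE => /andP[].
apply/drainsP => v; rewrite in_setD in_setU => /andP[/norP[Nv S'v] Wv].
have [Bv|B'v] := boolP (v \in basin W z).
  have disj y : y \in basin W z -> y \in W :\: (outs W z :|: S).
    move=> By; move: (By); rewrite basinP // => /andP[+ _].
    rewrite !(in_setD, in_setU) => /andP[/negPf-> ->] /=; rewrite andbT.
    by apply/negP => /(subsetP sSQ); rewrite !(in_setD, in_setU) By orbT.
  exists z.
    apply/sink_ofP; split=> [|w]; first exact: disj (basin_self _ _).
    by rewrite !inE => /andP[/norP[+ _] Ww]; rewrite Ww.
  move: Bv; rewrite basinP // => /andP[Av /connectP[p pp def_z]].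
  (* The path from v to z runs inside the basin, which [S] does not meet, so it survives the
     deletion. *)
  have: all (mem (basin W z)) (v :: p).
    have Bl : last v p \in basin W z by rewrite -def_z basin_self.
    elim: p v {Nv S'v Wv} Av Bl def_z pp => [|r p IHp] v Av /=.
      by move=> _ -> _; rewrite basin_self.
    move=> Bl def_z /andP[/[dup] vr /and3P[_ Ar _] pp].
    have /= -> := IHp r Ar Bl def_z pp; rewrite andbT basinP // Av.
    by apply/connectP; exists (r :: p) => //; apply/andP.
  move=> Bp; apply/connectP; exists p => //.
  elim: p v {Nv S'v Wv Av def_z} pp Bp => [|r p IHp] v //=.
  case/andP=> /and3P[_ _ vr] pp /and3P[Bv Br Bp].
  apply/andP; split; last by apply: IHp; rewrite //= Br.
  by rewrite inducedE !disj.
have Qv : v \in (W :\: cluster W z) :\: S.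
  by rewrite !(in_setD, in_setU) S'v Wv (negPf B'v) (negPf Nv).
have sQ : (W :\: cluster W z) :\: S \subset W :\: (outs W z :|: S).
  apply/subsetP => y; rewrite !(in_setD, in_setU) !negb_or.
  by case/and3P=> -> /andP[-> _] ->.
have [t /sink_ofP[Qt sink_t] vt] := drainsP _ drS v Qv.
exists t; last exact: connect_inducedS vt.
apply/sink_ofP; split=> [|w]; first exact: (subsetP sQ).
rewrite in_setD in_setU => /andP[/norP[N'w S'w] Ww]; apply/negP => tw.
have Q1t : t \in W :\: cluster W z by move: Qt; rewrite inE => /andP[].
have [Nw|Qw] := cluster_closed Wz Q1t Ww tw; first by rewrite Nw in N'w.
by have := sink_t w; rewrite in_setD S'w Qw tw => /(_ isT).
Qed.

Lemma sink_of_outs W S z :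
  S \subset W -> sink_of (W :\: S) z -> outs W z \subset S.
Proof.
move=> sSW /sink_ofP[_ sink_z]; apply/subsetP => y; rewrite inE => /andP[Wy zy].
by apply: contraTT zy => S'y; apply: sink_z; rewrite inE S'y.
Qed.

(** A kept x drains into a sink z along a path that avoids N(z), because N(z) is deleted. A deleted
    x must be an out-neighbour of some sink, as otherwise it could be restored. *)
Lemma opt_solution_covered W S x :
  solves W S -> #|S| = opt W -> x \in W ->
  exists2 z, sink_of (W :\: S) z & x \in cluster W z.
Proof.
case/andP=> sSW /drainsP dr optS Wx.
have [Sx|S'x] := boolP (x \in S); last first.
  have Ax : x \in W :\: S by rewrite inE S'x.
  have [z sz xz] := dr x Ax; exists z => //; have sN := sink_of_outs sSW sz.
  have sA : W :\: S \subset W :\: outs W z by apply: setDS.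
  have Wz : z \in W by case/sink_ofP: sz; rewrite inE => /andP[].
  by rewrite inE basinP // (subsetP sA) // (connect_inducedS sA) ?orbT.
have [/exists_inP[z sz zx]|/exists_inPn no_z] :=
    boolP [exists z in [set z | sink_of (W :\: S) z], D z x].
  by exists z; rewrite ?inE ?Wx ?zx // -[sink_of _ _]inE.
(* No sink points to x: the set without x is then a smaller solution, against optimality. *)
have: opt W <= #|S :\ x|; last by rewrite -optS [in X in X <= _](cardsD1 x) Sx ltnn.
apply: opt_min; rewrite /solves (subset_trans (subsetDl _ _) sSW) /=.
have sA : W :\: S \subset W :\: (S :\ x) by rewrite setDS ?subsetDl.
have sinkS z : sink_of (W :\: S) z -> sink_of (W :\: (S :\ x)) z.
  move=> sz; have := no_z z; rewrite inE => /(_ sz) zx.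
  case/sink_ofP: sz => Az sink_z; apply/sink_ofP.
  split=> [|w]; first exact: (subsetP sA).
  rewrite 2!inE; have [->|xw] //= := eqVneq w x.
  by rewrite inE xw /= => Aw; apply: sink_z; rewrite inE.
have drA v : v \in W :\: S ->
    exists2 t, sink_of (W :\: (S :\ x)) t & connect (induced (W :\: (S :\ x))) v t.
  by case/dr=> t /sinkS st /(connect_inducedS sA); exists t.
have A'x : x \in W :\: (S :\ x) by rewrite !inE eqxx.
apply/drainsP => v; have [->|v'x] := eqVneq v x; last first.
  by move=> A'v; apply: drA; move: A'v; rewrite !inE v'x.
(* The restored x either has a kept out-neighbour, whose sink it reaches, or is itself a new
   sink. *)
have [/exists_inP[y Ay xy]|/exists_inPn sx] :=
    boolP [exists y in W :\: S, D x y]; last first.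
  exists x; last exact: connect0.
  apply/sink_ofP; split=> // w; rewrite 2!inE.
  have [->|w'x] := eqVneq w x; first by rewrite arc_irrefl.
  by rewrite inE w'x /= => Aw; apply: sx; rewrite inE.
have [t st yt] := drA y Ay; exists t => //.
by apply: connect_trans yt; apply: connect1; rewrite inducedE A'x (subsetP sA).
Qed.

(** For the sink z that covers x, an optimal S contains N(z), and the part of S outside the cluster
    solves the complement: by [cluster_closed], a path of D[W] - S starting there can never leave
    it. *)
Lemma opt_ge_cluster W x : x \in W ->
  exists z, [/\ z \in W, x \in cluster W z
               & #|outs W z| + opt (W :\: cluster W z) <= opt W].
Proof.
move=> Wx; have [S solS optS] := opt_solution W.
have [z sz xz] := opt_solution_covered solS optS Wx.
case/andP: solS => sSW /drainsP dr; have sN := sink_of_outs sSW sz.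
have Wz : z \in W by case/sink_ofP: sz; rewrite inE => /andP[].
exists z; split=> //; set Q := W :\: cluster W z.
rewrite -optS -(cardsID (outs W z) S) (setIidPr sN) leq_add2l.
apply: leq_trans (subset_leq_card (_ : S :&: Q \subset S :\: outs W z)); last first.
  apply/subsetP => y; rewrite /Q !(in_setI, in_setD, in_setU) negb_or.
  by case/and3P=> -> /andP[-> _] _.
apply: opt_min; rewrite /solves subsetIr /=; apply/drainsP => v.
rewrite !(setDIr, setDv, setU0) => /setDP[Qv S'v].
have sA : Q :\: S \subset W :\: S by apply: setSD; apply: subsetDl.
have Av : v \in W :\: S by apply: (subsetP sA); rewrite inE S'v.
have stay u w : u \in Q -> w \in W :\: S -> D u w -> w \in Q :\: S.
  move=> Qu /setDP[Ww S'w] uw; rewrite in_setD S'w.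
  by case: (cluster_closed Wz Qu Ww uw) => // /(subsetP sN); rewrite (negPf S'w).
have [t /sink_ofP[At sink_t] /connectP[p pp def_t]] := dr v Av.
have [Qt vt] : t \in Q :\: S /\ connect (induced (Q :\: S)) v t.
  have Q'v : v \in Q :\: S by rewrite inE S'v.
  elim: p v Q'v {Qv S'v Av} pp def_t => [|r p IHp] v Qv /=.
    by move=> _ ->; rewrite connect0.
  case/andP=> /and3P[_ Ar vr] pp def_t.
  have Qr : r \in Q :\: S by apply: stay vr => //; case/setDP: Qv.
  have [Qt rt] := IHp r Qr pp def_t; split=> //.
  by apply: connect_trans rt; apply: connect1; rewrite inducedE Qv Qr.
exists t; last by [].
by apply/sink_ofP; split=> // w /(subsetP sA); apply: sink_t.
Qed.

End Clusters.

(** * Choice of the branching vertex and size of the search tree *)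

Section Branching.

Import Order.TTheory GRing.Theory Num.Theory.

(** Averaging: each z distributes a total of at most H over the vertices of its cluster, so not
    every x in W can receive more than H. *)
Lemma light_vertex (V : finType) (D : digraph V) (W : {set V}) (H : nat) :
  W != set0 ->
  exists2 x, x \in W
    & \sum_(z in W | x \in cluster D W z) H %/ #|cluster D W z| <= H.
Proof.
move=> /set0Pn[x0 Wx0]; apply/exists_inP; apply: contraT => /exists_inPn heavy.
have: \sum_(x in W) H
    < \sum_(x in W) \sum_(z in W | x \in cluster D W z) H %/ #|cluster D W z|.
  rewrite (bigD1 x0) //= [X in _ < X](bigD1 x0) //= -addSn leq_add //.
    by rewrite ltnNge heavy.
  by apply: leq_sum => x /andP[Wx _]; rewrite ltnW // ltnNge heavy.
(* Count by z instead of x: rounding down keeps the size of the cluster times its weight below H. *)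
rewrite (exchange_big_dep (mem W)) /=; last by move=> x z _ /andP[].
rewrite ltnNge leq_sum // => z Wz.
apply: leq_trans (leq_divM H #|cluster D W z|).
rewrite sum_nat_const mulnC leq_mul2l; apply/orP; right.
by apply/subset_leq_card/subsetP => x; rewrite unfold_in => /and3P[].
Qed.

Local Open Scope ring_scope.

Variable c : rat.
(** 16/11 = 1.4545... lies below 1.4549 and leaves enough room above 3^(1/3) = 1.4422... for the
    rounding of the weights. *)
Hypothesis c_large : 16 / 11 <= c.

Lemma c_gt0 : 0 < c. Proof. by move: c_large; lra. Qed.

Lemma c_ge1 : 1 <= c. Proof. by move: c_large; lra. Qed.

(* k / c^k is maximal at k = 3; already (16/11)^3 = 1.0258... * 3. *)
Lemma exp_c_ge k : 41 * k%:R <= 40 * c ^+ k.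
Proof.
have c2 : 256 / 121 <= c ^+ 2 by rewrite expr2; move: c_large; nra.
have c3 : 123 / 40 <= c ^+ 3 by rewrite exprS; move: c_large c2; nra.
case: k => [|[|[|k]]]; rewrite ?expr0 ?expr1; try by move: c_large c2; lra.
(* From 3 on, passing from k to k + 1 multiplies it by at most 4/3, which is less than c. *)
elim: k => [|k IHk]; first by move: c3; lra.
rewrite exprSr -natr1; have k3_ge3 : 3 <= (k.+3)%:R :> rat by rewrite ler_nat.
move: c_large IHk k3_ge3; set e := _ ^+ k.+3; set k3 := _%:R; nra.
Qed.

(** With q the rounded weight, H <= q k + k and k <= H / 41 give H <= (41/40) q k. This loss is
    exactly what [exp_c_ge] absorbs. *)
Lemma weight_ge (H k : nat) :
  (0 < k)%N -> (41 * k <= H)%N -> H%:R * c ^- k <= (H %/ k)%:R.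
Proof.
move=> k0 kH; rewrite ler_pdivrMr ?exprn_gt0 ?c_gt0 //.
have lt_H : (H < (H %/ k).+1 * k)%N by rewrite -ltn_divLR.
have hk : H%:R <= ((H %/ k)%:R + 1) * k%:R :> rat.
  by rewrite natr1 -natrM ler_nat ltnW.
have hH : 41 * k%:R <= H%:R :> rat by rewrite -natrM ler_nat.
have ck := exp_c_ge k; set q := (H %/ k)%:R in hk *.
have q0 : 0 <= q by rewrite ler0n.
apply: le_trans (_ : 41 / 40 * (q * k%:R) <= _); first by nra.
have := ler_wpM2l q0 ck; lra.
Qed.

(** Divided by H, the lightness condition becomes the usual characteristic inequality of a branching
    rule with decreases [k i]. *)
Lemma sum_branches (I : finType) (P : pred I) (k : I -> nat) (H : nat) :
  (0 < H)%N -> (forall i, P i -> 0 < k i)%N -> (forall i, P i -> 41 * k i <= H)%N ->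
  (\sum_(i | P i) H %/ k i <= H)%N -> \sum_(i | P i) c ^- k i <= 1.
Proof.
move=> H0 k0 kH sumH.
have HR : 0 < H%:R :> rat by rewrite ltr0n.
rewrite -(ler_pM2l HR) mulr1 mulr_sumr.
apply: le_trans (_ : (\sum_(i | P i) H %/ k i)%:R <= _); last by rewrite ler_nat.
by rewrite natr_sum; apply: ler_sum => i Pi; apply: weight_ge; auto.
Qed.

(** The search tree accounts for c^m; the factor m + 1 pays for the local work along the levels of
    the recursion. *)
Definition time_bound (A m : nat) : nat := Num.truncn (A%:R * m.+1%:R * c ^+ m).

Lemma time_bound_real_ge0 A m n : 0 <= A%:R * m%:R * c ^+ n.
Proof. by rewrite !mulr_ge0 ?ler0n ?exprn_ge0 // ltW ?c_gt0. Qed.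

Lemma time_bound_le A m : (time_bound A m)%:R <= A%:R * m.+1%:R * c ^+ m.
Proof. by rewrite truncn_le time_bound_real_ge0. Qed.

Lemma leq_time_bound A m : (A <= time_bound A m)%N.
Proof.
rewrite truncn_ge_nat ?time_bound_real_ge0 // -mulrA ler_peMr ?ler0n //.
by rewrite mulr_ege1 ?ler1n ?exprn_ege1 ?c_ge1.
Qed.

(** Split A (m + 1) c^m into A m c^m and A c^m. The first part covers the recursive calls, since m -
    k + 1 <= m and the c^-k sum to at most 1; the second covers the local work. *)
Lemma time_bound_rec (I : finType) (P : pred I) (k : I -> nat) (A A0 B m : nat) :
  (0 < m)%N -> (forall i, P i -> 0 < k i <= m)%N -> \sum_(i | P i) c ^- k i <= 1 ->
  (A0 + B * #|P| <= A)%N ->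
  (A0 + \sum_(i | P i) (time_bound A (m - k i) + B) <= time_bound A m)%N.
Proof.
move=> m0 km sum_c leA.
rewrite truncn_ge_nat ?time_bound_real_ge0 //.
rewrite big_split /= sum_nat_const addnCA mulnC natrD.
have cm : 1 <= c ^+ m by apply: exprn_ege1 c_ge1.
have -> : A%:R * m.+1%:R * c ^+ m
    = A%:R * m%:R * c ^+ m + A%:R * c ^+ m :> rat.
  by rewrite -natr1 mulrDr mulrDl mulr1.
apply: lerD; last first.
  by apply: le_trans (_ : A%:R <= _); rewrite ?ler_nat // ler_peMr ?ler0n.
rewrite natr_sum.
apply: le_trans (_ : A%:R * m%:R * c ^+ m * (\sum_(i | P i) c ^- k i) <= _).
  rewrite mulr_sumr; apply: ler_sum => i /km /andP[ki0 kim].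
  apply: le_trans (time_bound_le _ _) _.
  rewrite -[leRHS]mulrA -expfB_cond ?(gt_eqF c_gt0) // ler_wpM2r //.
    by rewrite exprn_ge0 // ltW ?c_gt0.
  by rewrite ler_wpM2l ?ler0n // ler_nat; lia.
by rewrite ler_piMr ?time_bound_real_ge0.
Qed.

End Branching.

(** * The program *)

Definition fMain := 0.
Definition fInter := 1.
Definition fAnd := 2.
Definition fOr := 3.
Definition fDiff := 4.
Definition fNbrs := 5.
Definition fBasin := 6.
Definition fZeros := 7.
Definition fPad := 8.
Definition fOnehots := 9.
Definition fOnes := 10.
Definition fUnits := 11.
Definition fCount := 12.
Definition fStrip := 13.
Definition fDiv := 14.
Definition fClusters := 15.
Definition fSelect := 16.
Definition fCat := 17.
Definition fWeight := 18.
Definition fChoose := 19.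
Definition fOpt := 20.
Definition fLoop := 21.
Definition fMin := 22.

(* Several arguments are passed as right-nested pairs.  On a leaf [Split]
   returns [Leaf], which encodes 0, false and the empty list alike. *)
Definition Split e1 e2 := Case e1 Nil e2.
Definition ExprTrue := Cons Nil Nil.

Definition bodyMain :=
  Call fOpt (Cons (Call fOnes (Var 0))
    (Cons (Call fOnehots (Var 0)) (Cons (Var 0) (Call fUnits (Var 0))))).

(** Applied to a singleton this tests membership, and applied to a set and itself it tests
    nonemptiness. *)
Definition bodyInter :=
  Split (Var 0) (Split (Var 0) (Split (Var 3)
    (Case (Var 2)
      (Call fInter (Cons (Var 3) (Var 1)))
      (Case (Var 2) (Call fInter (Cons (Var 5) (Var 3))) ExprTrue)))).

(** Inside [bit], index 2 is the current bit of the first vector and index 0 that of the second. *)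
Definition bodyZip f bit :=
  Split (Var 0) (Split (Var 0) (Split (Var 3)
    (Cons bit (Call f (Cons (Var 3) (Var 1)))))).

Definition bodyNbrs :=
  Split (Var 0) (Split (Var 0) (Split (Var 3) (Split (Var 0)
    (Cons (Split (Var 0) (Call fInter (Cons (Var 6) (Var 5))))
          (Call fNbrs (Cons (Var 5) (Cons (Var 1) (Var 3)))))))).

(* The first argument only counts the rounds of the fixpoint iteration. *)
Definition bodyBasin :=
  Split (Var 0) (Case (Var 0)
    (Split (Var 1) (Split (Var 1) (Var 1)))
    (Split (Var 3) (Split (Var 1)
      (Call fOr (Cons (Var 1) (Call fNbrs (Cons (Var 2) (Cons (Var 0)
        (Call fBasin (Cons (Var 5) (Var 7))))))))))).

Definition bodyZeros := Split (Var 0) (Cons Nil (Call fZeros (Var 1))).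

Definition bodyPad := Split (Var 0) (Cons (Cons Nil (Var 0)) (Call fPad (Var 1))).

(** A vertex is represented by the bit vector of its singleton, so that vertices are handled by set
    operations. *)
Definition bodyOnehots :=
  Split (Var 0) (Cons (Cons ExprTrue (Call fZeros (Var 1)))
                      (Call fPad (Call fOnehots (Var 1)))).

Definition bodyOnes := Split (Var 0) (Cons ExprTrue (Call fOnes (Var 1))).

(* A cluster of size k gets the integer weight [41 n %/ k]; this is [41 n]. *)
Definition bodyUnits :=
  Split (Var 0) (iter 41 (Cons Nil) (Call fUnits (Var 1))).

Definition bodyCount :=
  Split (Var 0) (Case (Var 0) (Var 1)
    (Case (Var 0)
      (Call fCount (Cons (Var 1) (Var 3)))
      (Cons Nil (Call fCount (Cons (Var 3) (Var 5)))))).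

(* [Leaf] signals that the second argument is larger. *)
Definition bodyStrip :=
  Split (Var 0) (Case (Var 1) (Cons (Var 0) Nil)
    (Split (Var 2) (Call fStrip (Cons (Var 1) (Var 3))))).

Definition bodyDiv :=
  Split (Var 0) (Split (Call fStrip (Var 2))
    (Cons Nil (Call fDiv (Cons (Var 0) (Var 3))))).

(** An entry stores all that choosing x and branching on z will need, so each cluster is computed
    once per call of [fOpt]. *)
Definition bodyClusters :=
  Split (Var 0) (Split (Var 0) (Split (Var 3) (Split (Var 0) (Split (Var 3)
    (Split (Var 1)
    (Let (Call fClusters (Cons (Var 9) (Cons (Var 5) (Var 7))))
    (Case (Call fInter (Cons (Var 9) (Var 1))) (Var 0)
    (Let (Call fAnd (Cons (Var 7) (Var 3)))
    (Let (Call fOr (Cons (Var 0) (Call fBasin (Cons (Var 6) (Cons (Var 6)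
            (Cons (Call fDiff (Cons (Var 4) (Var 0))) (Var 12)))))))
    (Cons (Cons (Var 13)
            (Cons (Call fDiv (Cons (Var 6) (Call fCount (Cons (Var 0) Nil))))
              (Cons (Var 1) (Var 0))))
          (Var 4))))))))))).

Definition bodySelect :=
  Split (Var 0) (Split (Var 1)
    (Let (Call fSelect (Cons (Var 2) (Var 1)))
    (Split (Var 1) (Split (Var 1) (Split (Var 1)
      (Case (Call fInter (Cons (Var 9) (Var 1)))
        (Var 6) (Cons (Var 9) (Var 8)))))))).

Definition bodyCat :=
  Split (Var 0) (Case (Var 0) (Var 1)
    (Cons (Var 0) (Call fCat (Cons (Var 1) (Var 3))))).

Definition bodyWeight :=
  Split (Var 0) (Split (Var 0) (Split (Var 1)
    (Call fCat (Cons (Var 0) (Call fWeight (Var 5)))))).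

(** The result is the list of branches of the first light vertex, not the vertex. [light_vertex]
    ensures that the search succeeds. *)
Definition bodyChoose :=
  Split (Var 0) (Split (Var 0) (Split (Var 3) (Split (Var 2)
    (Let (Call fSelect (Cons (Var 0) (Var 2)))
    (Case (Call fStrip (Cons (Var 4) (Call fWeight (Var 0))))
      (Call fChoose (Cons (Var 6) (Var 8)))
      (Var 2)))))).

(** When W is empty the first test makes [Split] return [Leaf], which is the correct optimum 0. *)
Definition bodyOpt :=
  Split (Var 0) (Split (Call fInter (Cons (Var 0) (Var 0)))
    (Split (Var 3) (Split (Var 1)
    (Let (Call fClusters (Cons (Var 2) (Cons (Var 0) (Cons (Var 0)
            (Cons (Var 6) (Var 1))))))
      (Call fLoop (Cons (Call fChoose (Cons (Var 0) (Cons (Var 0) (Var 2))))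
                        (Cons (Var 7) (Var 8)))))))).

(** The last branch is treated apart, because a minimum over no branches has no value. *)
Definition bodyLoop :=
  Split (Var 0) (Split (Var 0) (Split (Var 3) (Split (Var 2) (Split (Var 1)
    (Split (Var 1)
    (Let (Call fCount (Cons (Var 0)
            (Call fOpt (Cons (Call fDiff (Cons (Var 6) (Var 1))) (Var 7)))))
    (Case (Var 10) (Var 0)
      (Call fMin (Cons (Var 2)
        (Call fLoop (Cons (Var 12) (Var 14)))))))))))).

Definition bodyMin :=
  Split (Var 0) (Case (Call fStrip (Var 2)) (Var 0) (Var 3)).

Definition solver : program :=
  [:: bodyMain; bodyInter;
      bodyZip fAnd (Split (Var 2) (Var 2));
      bodyZip fOr (Case (Var 2) (Var 0) ExprTrue);
      bodyZip fDiff (Split (Var 2) (Case (Var 2) ExprTrue Nil));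
      bodyNbrs; bodyBasin; bodyZeros; bodyPad; bodyOnehots; bodyOnes; bodyUnits;
      bodyCount; bodyStrip; bodyDiv; bodyClusters; bodySelect; bodyCat;
      bodyWeight; bodyChoose; bodyOpt; bodyLoop; bodyMin].

(** * Evaluation within a time bound, and symbolic execution *)

Definition evalb env e v T := exists2 t, eval solver env e v t & t <= T.

Definition computes f x y T := evalb [:: x] (nth Nil solver f) y T.

(** Working with upper bounds lets runs of different lengths share one formula. *)
Lemma evalb_le env e v T T' : evalb env e v T -> T <= T' -> evalb env e v T'.
Proof. by case=> t ev tT TT'; exists t; rewrite // (leq_trans tT). Qed.

Lemma evalb_var env i v : nth Leaf env i = v -> evalb env (Var i) v 1.
Proof. by move=> <-; exists 1; first exact: EvalVar. Qed.

Lemma evalb_nil env : evalb env Nil Leaf 1.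
Proof. by exists 1; first exact: EvalNil. Qed.

Lemma evalb_cons env e1 e2 v1 v2 T1 T2 :
  evalb env e1 v1 T1 -> evalb env e2 v2 T2 ->
  evalb env (Cons e1 e2) (Node v1 v2) (T1 + T2).+1.
Proof.
by case=> t1 ev1 le1 [t2 ev2 le2]; exists (t1 + t2).+1; [apply: EvalCons | lia].
Qed.

Lemma evalb_let env e1 e2 v1 v2 T1 T2 :
  evalb env e1 v1 T1 -> evalb (v1 :: env) e2 v2 T2 ->
  evalb env (Let e1 e2) v2 (T1 + T2).+1.
Proof.
case=> t1 ev1 le1 [t2 ev2 le2]; exists (t1 + t2).+1; last lia.
exact: EvalLet ev1 ev2.
Qed.

(** One rule serves both constructors: the [match] reduces as soon as the value [d] is known. *)
Lemma evalb_case env e e0 e1 d v T T' :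
  evalb env e d T ->
  match d with
  | Leaf => evalb env e0 v T'
  | Node l r => evalb (l :: r :: env) e1 v T'
  end ->
  evalb env (Case e e0 e1) v (T + T').+1.
Proof.
case=> t ev le; case: d ev => [|l r] ev [t' ev' le']; exists (t + t').+1; try lia.
  exact: EvalCaseLeaf ev ev'.
exact: EvalCaseNode ev ev'.
Qed.

Lemma evalb_call env f e v w T T' :
  evalb env e v T -> computes f v w T' -> evalb env (Call f e) w (T + T').+1.
Proof.
case=> t ev le [t' ev' le']; exists (t + t').+1; last lia.
exact: EvalCall ev ev'.
Qed.

Create HintDb computes.

(** Symbolic execution: the syntax selects the rule, calls are closed by hypotheses or hints, and
    the accumulated time remains to be compared with the claimed bound. *)
Ltac exec :=
  lazymatch goal with |- evalb ?env ?e ?v ?T =>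
    let e' := eval hnf in e in change (evalb env e' v T) end;
  lazymatch goal with
  | |- evalb ?env (Var ?i) _ _ =>
      let d := eval cbn [nth] in (nth Leaf env i) in
      exact (@evalb_var env i d (erefl d))
  | |- evalb _ Nil _ _ => exact: evalb_nil
  | |- evalb _ (Cons _ _) _ _ => eapply evalb_cons; [exec | exec]
  | |- evalb _ (Let _ _) _ _ => eapply evalb_let; [exec | exec]
  | |- evalb _ (Case _ _ _) _ _ => eapply evalb_case; [exec | cbn beta iota; exec]
  | |- evalb _ (Call _ _) _ _ =>
      eapply evalb_call; [exec | first [eassumption | solve [eauto with computes]]]
  end.

Ltac run_body := eapply evalb_le; [rewrite /computes; exec | ].

(** * Sets as bit vectors *)

Section Bits.

Variable T : Type.
Implicit Types (f g : T -> bool) (s : seq T).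

Definition bits f s := tree_of_seq [seq tree_of_bool (f v) | v <- s].

Lemma bits_nil f : bits f [::] = Leaf. Proof. by []. Qed.

Lemma bits_cons f x s : bits f (x :: s) = Node (tree_of_bool (f x)) (bits f s).
Proof. by []. Qed.

Lemma eq_bits f g s : f =1 g -> bits f s = bits g s.
Proof. by move=> fg; rewrite /bits (eq_map (fun v => congr1 _ (fg v))). Qed.

Lemma computes_inter f g s :
  computes fInter (Node (bits f s) (bits g s))
    (tree_of_bool (has (fun v => f v && g v) s)) (30 * (size s).+1).
Proof.
elim: s => [|x s IHs]; rewrite ?(bits_nil, bits_cons) /=; first by run_body; lia.
case: (f x) => /=; last by run_body; lia.
case: (g x) => /=; run_body; lia.
Qed.

Lemma computes_and f g s :
  computes fAnd (Node (bits f s) (bits g s)) (bits (fun v => f v && g v) s)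
    (30 * (size s).+1).
Proof.
elim: s => [|x s IHs]; rewrite ?(bits_nil, bits_cons) /=; first by run_body; lia.
by case: (f x) => /=; run_body; lia.
Qed.

Lemma computes_or f g s :
  computes fOr (Node (bits f s) (bits g s)) (bits (fun v => f v || g v) s)
    (30 * (size s).+1).
Proof.
elim: s => [|x s IHs]; rewrite ?(bits_nil, bits_cons) /=; first by run_body; lia.
by case: (f x) => /=; run_body; lia.
Qed.

Lemma computes_diff f g s :
  computes fDiff (Node (bits f s) (bits g s)) (bits (fun v => f v && ~~ g v) s)
    (30 * (size s).+1).
Proof.
elim: s => [|x s IHs]; rewrite ?(bits_nil, bits_cons) /=; first by run_body; lia.
by case: (f x) => /=; case: (g x) => /=; run_body; lia.
Qed.

Lemma computes_zeros (h : T -> tree) s :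
  computes fZeros (tree_of_seq (map h s)) (bits (fun=> false) s) (30 * (size s).+1).
Proof. by elim: s => [|x s IHs] /=; rewrite ?(bits_nil, bits_cons); run_body; lia. Qed.

Lemma computes_ones (h : T -> tree) s :
  computes fOnes (tree_of_seq (map h s)) (bits (fun=> true) s) (30 * (size s).+1).
Proof. by elim: s => [|x s IHs] /=; rewrite ?(bits_nil, bits_cons); run_body; lia. Qed.

Lemma computes_count f s m :
  computes fCount (Node (bits f s) (tree_of_nat m))
    (tree_of_nat (count f s + m)) (30 * (size s).+1).
Proof.
elim: s => [|x s IHs]; rewrite ?(bits_nil, bits_cons) /=; first by run_body; lia.
by case: (f x) => /=; run_body; lia.
Qed.

End Bits.
#[local] Hint Resolve computes_inter computes_and computes_or computes_diff : computes.
#[local] Hint Resolve computes_zeros computes_ones computes_count : computes.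

(** * Unary arithmetic and one-hot vectors *)

Lemma tree_of_nat0 : tree_of_nat 0 = Leaf. Proof. by []. Qed.

Lemma tree_of_natS m : tree_of_nat m.+1 = Node Leaf (tree_of_nat m).
Proof. by []. Qed.

Lemma computes_strip a b :
  computes fStrip (Node (tree_of_nat a) (tree_of_nat b))
    (if b <= a then Node (tree_of_nat (a - b)) Leaf else Leaf)
    (30 * (minn a b).+1).
Proof.
by elim: b a => [|b IHb] [|a]; rewrite ?(tree_of_nat0, tree_of_natS) /=;
  run_body; lia.
Qed.
#[local] Hint Resolve computes_strip : computes.

Lemma computes_div H k : 0 < k ->
  computes fDiv (Node (tree_of_nat H) (tree_of_nat k)) (tree_of_nat (H %/ k))
    (50 * k.+1 * H.+1).
Proof.
move=> k0; elim/ltn_ind: H => H IH.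
have st := computes_strip H k; case: leqP st => [kH|Hk] st; last first.
  by rewrite divn_small //; run_body; nia.
have IHk := IH (H - k) ltac:(lia).
have -> : H %/ k = ((H - k) %/ k).+1 by rewrite -{1}(subnK kH) divnDr ?divnn ?k0 ?addn1.
rewrite tree_of_natS; run_body; nia.
Qed.

Lemma computes_cat a b :
  computes fCat (Node (tree_of_nat a) (tree_of_nat b)) (tree_of_nat (a + b))
    (30 * a.+1).
Proof.
by elim: a => [|a IHa]; rewrite ?(tree_of_nat0, tree_of_natS) /=; run_body; lia.
Qed.
#[local] Hint Resolve computes_cat : computes.

Lemma computes_min a b :
  computes fMin (Node (tree_of_nat a) (tree_of_nat b)) (tree_of_nat (minn a b))
    (30 * (minn a b).+2).
Proof.
by have := computes_strip a b; case: leqP => ab st; run_body; lia.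
Qed.
#[local] Hint Resolve computes_min : computes.

Lemma computes_units (T : Type) (h : T -> tree) (s : seq T) :
  computes fUnits (tree_of_seq (map h s)) (tree_of_nat (41 * size s))
    (200 * (size s).+1).
Proof.
elim: s => [|x s IHs]; first by rewrite muln0 /=; run_body; lia.
by rewrite [size _]/= mulnS /=; run_body; lia.
Qed.

Lemma computes_pad (T : Type) (F : T -> tree) (l : seq T) :
  computes fPad (tree_of_seq [seq F x | x <- l])
    (tree_of_seq [seq Node Leaf (F x) | x <- l]) (30 * (size l).+1).
Proof. by elim: l => [|x l IHl] /=; run_body; lia. Qed.

Lemma computes_onehots (T : eqType) (h : T -> tree) (s : seq T) :
  uniq s ->
  computes fOnehots (tree_of_seq (map h s))
    (tree_of_seq [seq bits (eq_op^~ x) s | x <- s]) (100 * (size s).+1 * (size s).+1).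
Proof.
elim: s => [|x s IHs] => [_|/andP[s'x /IHs{}IHs]]; first by rewrite /=; run_body.
rewrite map_cons /= bits_cons eqxx.
(* Since x does not occur in s, the vectors of s start with a zero at x, and the vector of x is zero
   on s. *)
have <- : [seq Node Leaf (bits (eq_op^~ y) s) | y <- s]
    = [seq bits (eq_op^~ y) (x :: s) | y <- s].
  apply/eq_in_map => y sy; rewrite bits_cons; case: eqP sy s'x => // ->.
  by move=> ->.
have <- : bits (fun=> false) s = bits (eq_op^~ x) s.
  congr tree_of_seq; apply/eq_in_map => y sy; case: eqP sy s'x => // ->.
  by move=> ->.
have pad := computes_pad (fun y => bits (eq_op^~ y) s) s.
have zer := computes_zeros h s.
by run_body; nia.
Qed.

(** * Correctness and running time of the program *)

Section Costs.

Variable n : nat.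

Definition costBits := 30 * n.+1.
Definition costNbrs := (costBits + 100) * n.+1.
Definition costBasin := (costNbrs + costBits + 100) * n.+1.
Definition costDiv := 50 * n.+1 * (41 * n).+1.
Definition costClusters := (costBasin + 5 * costBits + costDiv + 300) * n.+1.
Definition costSelect := (costBits + 100) * n.+1.
Definition costWeight := (30 * (41 * n).+1 + 100) * n.+1.
Definition costChoose :=
  (costSelect + costWeight + 30 * (41 * n).+1 + 200) * n.+1.
Definition costBranch := 3 * costBits + 300.
Definition costOpt := costBits + costClusters + costChoose + costBranch * n + 300.
Definition costMain := costBits + 100 * n.+1 * n.+1 + 200 * n.+1 + 100.

End Costs.

Section Machine.

Variables (V : finType) (D : digraph V).
Implicit Types (A B W X : {set V}) (l : seq V).

Let n := #|V|.

Definition set_tree A := bits (fun v => v \in A) (enum V).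

Definition rows l := tree_of_seq [seq bits (D u) (enum V) | u <- l].

Definition singletons l := tree_of_seq [seq set_tree [set x] | x <- l].

Definition entry W z :=
  Node (set_tree [set z])
    (Node (tree_of_nat (41 * n %/ #|cluster D W z|))
      (Node (set_tree (outs D W z)) (set_tree (cluster D W z)))).

Definition entries W l := tree_of_seq [seq entry W z | z <- l].

Lemma rows_cons u l : rows (u :: l) = Node (bits (D u) (enum V)) (rows l).
Proof. by []. Qed.

Lemma singletons_cons u l :
  singletons (u :: l) = Node (set_tree [set u]) (singletons l).
Proof. by []. Qed.

Lemma entries_cons W z l : entries W (z :: l) = Node (entry W z) (entries W l).
Proof. by []. Qed.

Lemma size_enum : size (enum V) = n. Proof. by rewrite /n cardT. Qed.

Lemma count_set_tree A : count (fun v => v \in A) (enum V) = #|A|.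
Proof. by rewrite -size_filter cardE enumT unlock. Qed.

Lemma set_treeE A (f : V -> bool) :
  (forall v, (v \in A) = f v) -> set_tree A = bits f (enum V).
Proof. by move=> Af; apply: eq_bits. Qed.

(** Rows and mask are consumed together along [l], while the target [g] stays a vector over all of
    [V]; hence the separate list. *)
Lemma computes_nbrs (a g : V -> bool) l :
  size l <= n ->
  computes fNbrs (Node (rows l) (Node (bits a l) (bits g (enum V))))
    (bits (fun y => a y && has (fun v => D y v && g v) (enum V)) l)
    ((costBits n + 100) * (size l).+1).
Proof.
elim: l => [|u l IHl] ln; first by rewrite /rows !bits_nil /=; run_body; lia.
have {}IHl := IHl (ltnW ln).
have inter := computes_inter (D u) g (enum V).
rewrite size_enum -/(costBits n) in inter.
by rewrite rows_cons !bits_cons /=; case: (a u) => /=; run_body; lia.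
Qed.

Lemma has_meet A B :
  has (fun v => (v \in A) && (v \in B)) (enum V) = (A :&: B != set0).
Proof.
apply/hasP/set0Pn => -[v]; first by exists v; rewrite inE.
by rewrite inE => AB; exists v; rewrite ?mem_enum.
Qed.

Lemma has_set1 x A : has (fun v => (v \in [set x]) && (v \in A)) (enum V) = (x \in A).
Proof.
rewrite has_meet; apply/set0Pn/idP => [[v]|Ax]; last by exists x; rewrite !inE eqxx.
by rewrite !inE => /andP[/eqP->].
Qed.

Lemma computes_basin_iter W z l :
  size l <= n ->
  computes fBasin (Node (rows l) (Node (rows (enum V))
      (Node (set_tree (W :\: outs D W z)) (set_tree [set z]))))
    (set_tree (iter (size l).+1 (feeders D W z) set0))
    ((costNbrs n + costBits n + 100) * (size l).+1).
Proof.
elim: l => [|u l IHl] ln.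
  (* With an exhausted counter the program returns {z}, which is already the first iterate: hence
     one round more than the length of [l]. *)
  have -> : iter (size ([::] : seq V)).+1 (feeders D W z) set0 = [set z].
    apply/setP => y; rewrite !inE; case: (y == z) => //=; apply/negP => /andP[_].
    by case/exists_inP => r; rewrite inE.
  by rewrite /rows /=; run_body; lia.
have {}IHl := IHl (ltnW ln); rewrite rows_cons [size _]/= [iter _.+2 _ _]iterS.
set X := iter _ _ _ in IHl *.
rewrite (@set_treeE (feeders D W z X) (fun y => (y \in [set z])
  || (y \in W :\: outs D W z) && has (fun v => D y v && (v \in X)) (enum V))); last first.
  move=> y; rewrite /feeders in_setU; congr (_ || _); rewrite inE; congr (_ && _).
  apply/exists_inP/hasP => -[r].
    by exists r; rewrite ?mem_enum // andbC; apply/andP.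
  by move=> _ /andP[]; exists r.
have nb := @computes_nbrs (fun y => y \in W :\: outs D W z) (fun y => y \in X) (enum V).
rewrite size_enum -/(costNbrs n) leqnn in nb; have {}nb := nb isT.
have uni := computes_or (fun y => y \in [set z]) (fun y => (y \in W :\: outs D W z)
   && has (fun v => D y v && (v \in X)) (enum V)) (enum V).
rewrite size_enum -/(costBits n) in uni.
by run_body; lia.
Qed.

Lemma computes_basin W z :
  computes fBasin (Node (rows (enum V)) (Node (rows (enum V))
      (Node (set_tree (W :\: outs D W z)) (set_tree [set z]))))
    (set_tree (basin D W z)) (costBasin n).
Proof.
have := @computes_basin_iter W z (enum V); rewrite size_enum leqnn => /(_ isT).
(* The extra round is harmless at the fixpoint. *)
by rewrite iterS -/(fixset _) fixsetK //; apply: feeders_homo.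
Qed.

Lemma computes_cluster_weight W z : z \in W ->
  computes fDiv
    (Node (tree_of_nat (41 * n)) (tree_of_nat #|cluster D W z|))
    (tree_of_nat (41 * n %/ #|cluster D W z|)) (costDiv n).
Proof.
move=> Wz; have cl0 : 0 < #|cluster D W z|.
  by apply/card_gt0P; exists z; apply: cluster_self.
apply: evalb_le (computes_div _ cl0) _; rewrite /costDiv.
by rewrite leq_mul2r leq_mul2l ltnS max_card orbT.
Qed.

Lemma computes_clusters W l :
  size l <= n ->
  computes fClusters (Node (singletons l) (Node (rows l)
      (Node (rows (enum V)) (Node (set_tree W) (tree_of_nat (41 * n))))))
    (entries W [seq z <- l | z \in W])
    ((costBasin n + 5 * costBits n + costDiv n + 300) * (size l).+1).
Proof.
elim: l => [|z l IHl] ln.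
  by rewrite /singletons /rows /entries /=; run_body; lia.
have {}IHl := IHl (ltnW ln); rewrite singletons_cons rows_cons /=.
have inter := computes_inter (fun v => v \in [set z]) (fun v => v \in W) (enum V).
rewrite has_set1 size_enum -/(costBits n) -/(set_tree _) -/(set_tree _) in inter.
case: ifP inter => [Wz|_] /= inter; last by run_body; lia.
rewrite entries_cons /entry.
have and_outs : computes fAnd (Node (bits (D z) (enum V)) (set_tree W))
    (set_tree (outs D W z)) (costBits n).
  rewrite (@set_treeE (outs D W z) (fun v => D z v && (v \in W))); last first.
    by move=> v; rewrite inE andbC.
  by rewrite /costBits -size_enum; apply: computes_and.
have diff : computes fDiff (Node (set_tree W) (set_tree (outs D W z)))
    (set_tree (W :\: outs D W z)) (costBits n).
  rewrite (@set_treeE (W :\: outs D W z)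
             (fun v => (v \in W) && ~~ (v \in outs D W z))); last first.
    by move=> v; rewrite in_setD andbC.
  by rewrite /costBits -size_enum; apply: computes_diff.
have or_cl : computes fOr (Node (set_tree (outs D W z)) (set_tree (basin D W z)))
    (set_tree (cluster D W z)) (costBits n).
  rewrite (@set_treeE (cluster D W z)
             (fun v => (v \in outs D W z) || (v \in basin D W z))); last first.
    by move=> v; rewrite in_setU.
  by rewrite /costBits -size_enum; apply: computes_or.
have basinz := computes_basin W z.
have cnt := computes_count (fun v => v \in cluster D W z) (enum V) 0.
rewrite count_set_tree addn0 size_enum -/(costBits n) tree_of_nat0
  -/(set_tree _) in cnt.
have divz := computes_cluster_weight Wz.
by run_body; lia.
Qed.

Lemma computes_select W x l :
  size l <= n ->
  computes fSelect (Node (set_tree [set x]) (entries W l))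
    (entries W [seq z <- l | x \in cluster D W z])
    ((costBits n + 100) * (size l).+1).
Proof.
elim: l => [|z l IHl] ln; first by rewrite /entries /=; run_body; lia.
have {}IHl := IHl (ltnW ln); rewrite entries_cons /=.
have inter := computes_inter (fun v => v \in [set x])
                (fun v => v \in cluster D W z) (enum V).
rewrite has_set1 size_enum -/(costBits n) -/(set_tree _) -/(set_tree _) in inter.
case: ifP inter => [Wz|_] /= inter; rewrite ?entries_cons /entry; run_body; lia.
Qed.

Lemma computes_weight W l :
  computes fWeight (entries W l)
    (tree_of_nat (\sum_(z <- l) 41 * n %/ #|cluster D W z|))
    ((30 * (41 * n).+1 + 100) * (size l).+1).
Proof.
elim: l => [|z l IHl]; first by rewrite big_nil /entries /=; run_body; lia.
rewrite big_cons entries_cons /entry /=.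
have : 41 * n %/ #|cluster D W z| <= 41 * n by apply: leq_div.
set h := _ %/ _; move: h => h le_h; run_body; nia.
Qed.

Definition weight W x l :=
  \sum_(z <- l | x \in cluster D W z) 41 * n %/ #|cluster D W z|.

(** The candidates [l'] shrink during the search, while weights are always taken over the full list
    [l]. A heavy head is not the promised light vertex, so that vertex is in the tail. *)
Lemma computes_choose W l l' :
  size l <= n -> size l' <= n -> (exists2 x, x \in l' & weight W x l <= 41 * n) ->
  exists x, [/\ x \in l', weight W x l <= 41 * n &
    computes fChoose (Node (entries W l') (Node (entries W l) (tree_of_nat (41 * n))))
      (entries W [seq z <- l | x \in cluster D W z])
      ((costSelect n + costWeight n + 30 * (41 * n).+1 + 200) * (size l').+1)].
Proof.
move=> ln; elim: l' => [|x l' IHl'] ln' [y l'y light]; first by [].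
have sel : computes fSelect (Node (set_tree [set x]) (entries W l))
    (entries W [seq z <- l | x \in cluster D W z]) (costSelect n).
  apply: evalb_le (computes_select _ _ ln) _.
  by rewrite /costSelect leq_mul2l ltnS ln orbT.
have wt : computes fWeight (entries W [seq z <- l | x \in cluster D W z])
    (tree_of_nat (weight W x l)) (costWeight n).
  rewrite /weight -big_filter; apply: evalb_le (computes_weight _ _) _.
  rewrite /costWeight leq_mul2l ltnS size_filter.
  by rewrite (leq_trans (count_size _ _) ln) orbT.
have str := computes_strip (41 * n) (weight W x l).
case: leqP str => [lightx|heavyx] str.
  exists x; split=> //; first exact: mem_head.
  by rewrite entries_cons /entry; run_body; lia.
have [|x' [l'x' lightx' IH]] := IHl' (ltnW ln').
  exists y => //; move: l'y; rewrite inE => /predU1P[yx|//].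
  by rewrite -yx ltnNge light in heavyx.
exists x'; split=> //; first by rewrite inE l'x' orbT.
by rewrite entries_cons /entry /=; run_body; lia.
Qed.

Definition branch W z := #|outs D W z| + opt D (W :\: cluster D W z).

Definition context :=
  Node (singletons (enum V)) (Node (rows (enum V)) (tree_of_nat (41 * n))).

Lemma opt_le_card W : opt D W <= #|W|.
Proof. exact/opt_min/solves_all. Qed.

Lemma branch_le W z : z \in W -> branch W z <= n.
Proof.
move=> Wz; rewrite /branch (leq_trans _ (max_card (mem W))) //.
rewrite -(cardsID (cluster D W z) W) (setIidPr (cluster_sub D Wz)).
by rewrite leq_add ?opt_le_card // subset_leq_card // subsetUl.
Qed.

(** The recursive calls enter as hypotheses with abstract costs [t], to be supplied by the induction
    in [computes_opt]. *)
Lemma computes_loop W l (t : V -> nat) :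
  l != [::] -> {in l, forall z, z \in W} ->
  {in l, forall z, computes fOpt (Node (set_tree (W :\: cluster D W z)) context)
                     (tree_of_nat (opt D (W :\: cluster D W z))) (t z)} ->
  exists2 m, (exists2 z, z \in l & m = branch W z)
             /\ {in l, forall z, m <= branch W z} &
    computes fLoop (Node (entries W l) (Node (set_tree W) context))
      (tree_of_nat m) (\sum_(z <- l) (t z + costBranch n)).
Proof.
elim: l => // z l IHl _ Wl recl.
have Wz : z \in W by apply: Wl; rewrite mem_head.
have recz := recl z (mem_head z l).
have diff : computes fDiff (Node (set_tree W) (set_tree (cluster D W z)))
    (set_tree (W :\: cluster D W z)) (costBits n).
  rewrite (@set_treeE (W :\: cluster D W z)
             (fun v => (v \in W) && ~~ (v \in cluster D W z))); last first.
    by move=> v; rewrite in_setD andbC.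
  by rewrite /costBits -size_enum; apply: computes_diff.
have cnt := computes_count (fun v => v \in outs D W z) (enum V)
              (opt D (W :\: cluster D W z)).
rewrite count_set_tree size_enum -/(costBits n) -/(set_tree _) -/(branch W z) in cnt.
have [l0|l1] := eqVneq l [::].
  exists (branch W z); first by rewrite l0; split=> [|y]; rewrite ?inE;
    [exists z; rewrite ?inE | move=> /eqP->].
  rewrite entries_cons /entry l0 big_cons big_nil addn0 /entries /= /costBranch.
  by run_body; lia.
have [|y ly|y ly|m [[y ly def_m] min_m] IH] := IHl.
- by [].
- by apply: Wl; rewrite inE ly orbT.
- by apply: recl; rewrite inE ly orbT.
exists (minn (branch W z) m).
  split=> [|x]; last first.
    rewrite in_cons => /predU1P[->|lx]; first exact: geq_minl.
    exact: leq_trans (geq_minr _ _) (min_m _ lx).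
  case/orP: (leq_total (branch W z) m) => [/minn_idPl->|/minn_idPr->].
    by exists z; [apply: mem_head | reflexivity].
  by exists y; [rewrite in_cons ly orbT | exact: def_m].
(* The time of [fMin] grows with its result, so this bound keeps it within [costBranch n]. *)
have mn : minn (branch W z) m <= n by apply: leq_trans (geq_minl _ _) (branch_le Wz).
case: l l1 {IHl Wl recl ly min_m} IH => // y' l _ IH.
rewrite big_cons entries_cons /entry; rewrite entries_cons in IH *.
move: (\sum_(_ <- _) _) IH => cost IH.
by rewrite /costBranch; run_body; rewrite /costBits; lia.
Qed.

(** Induction on the size of W. [A] can stay fixed throughout, because the local work is bounded in
    terms of [n] and not of W. *)
Lemma computes_opt (c : rat) W (A : nat) :
  (16 / 11 <= c)%R -> costOpt n <= A ->
  computes fOpt (Node (set_tree W) context) (tree_of_nat (opt D W))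
    (time_bound c A #|W|).
Proof.
move=> c_large leA; move: {2}#|W|.+1 (ltnSn #|W|) => k.
elim: k W => // k IHk W; rewrite ltnS => leWk.
have inter := computes_inter (fun v => v \in W) (fun v => v \in W) (enum V).
rewrite has_meet setIid size_enum -/(costBits n) -/(set_tree W) in inter.
have [W0|W1] := eqVneq W set0.
  rewrite W0 eqxx /= -W0 in inter; rewrite {2}W0 opt0 tree_of_nat0.
  apply: (@evalb_le _ _ _ (costOpt n)).
    by run_body; rewrite /costOpt; lia.
  exact: leq_trans leA (leq_time_bound c_large _ _).
rewrite W1 /= in inter.
pose L := [seq z <- enum V | z \in W].
have memL z : (z \in L) = (z \in W) by rewrite mem_filter mem_enum andbT.
have sizeL : size L <= n by rewrite size_filter -size_enum count_size.
have weightE x : weight W x L =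
    \sum_(z in W | x \in cluster D W z) 41 * n %/ #|cluster D W z|.
  by rewrite /weight big_filter_cond big_enum_cond.
have [|x [Lx light choose]] := @computes_choose W L L sizeL sizeL.
  have [x Wx light] := light_vertex D (41 * n) W1.
  by exists x; rewrite ?memL // weightE.
set l := [seq z <- L | _] in choose.
have meml z : (z \in l) = (z \in W) && (x \in cluster D W z).
  by rewrite mem_filter memL andbC.
(* This branch attains the optimum; it also shows that the list of branches is nonempty. *)
have [z0 [Wz0 xz0 opt_ge]] : exists z, [/\ z \in W, x \in cluster D W z
    & branch W z <= opt D W] by apply: opt_ge_cluster; rewrite -memL.
have [|z|z lz|m [[z lz def_m] min_m] loop] :=
    @computes_loop W l (fun z => time_bound c A #|W :\: cluster D W z|).
- by apply/eqP => l0; have := meml z0; rewrite l0 Wz0 xz0.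
- by rewrite meml => /andP[].
- apply: IHk; apply: leq_trans leWk; rewrite -(cardsID (cluster D W z) W).
  rewrite -add1n leq_add2r; apply/card_gt0P; exists z.
  by rewrite inE cluster_self andbT; move: lz; rewrite meml => /andP[].
have m_opt : m = opt D W.
  apply/eqP; rewrite eqn_leq (leq_trans (min_m z0 _) opt_ge) ?meml ?Wz0 //=.
  by rewrite def_m opt_le_cluster //; move: lz; rewrite meml => /andP[].
rewrite m_opt in loop.
have clus : computes fClusters (Node (singletons (enum V)) (Node (rows (enum V))
    (Node (rows (enum V)) (Node (set_tree W) (tree_of_nat (41 * n))))))
    (entries W L) (costClusters n).
  by rewrite /costClusters -[X in _ * X.+1]size_enum; apply: computes_clusters;
    rewrite size_enum.
have {}choose : computes fChoose (Node (entries W L) (Node (entries W L)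
    (tree_of_nat (41 * n)))) (entries W l) (costChoose n).
  by apply: evalb_le choose _; rewrite /costChoose leq_mul2l ltnS sizeL orbT.
(* [costOpt] reserves [costBranch] for up to n branches; that share is charged to the branches
   themselves. *)
apply: (@evalb_le _ _ _ (costOpt n - costBranch n * n
    + \sum_(z <- l) (time_bound c A #|W :\: cluster D W z| + costBranch n))).
  move: (\sum_(_ <- _) _) loop => cost; rewrite /context => loop; run_body.
  by rewrite /costOpt; lia.
rewrite /l /L big_filter big_filter_cond big_enum_cond /=.
have cardW y : y \in W -> #|W :\: cluster D W y| = #|W| - #|cluster D W y|.
  by move=> Wy; rewrite cardsD (setIidPr (cluster_sub D Wy)).
rewrite (eq_bigr (fun z =>
  time_bound c A (#|W| - #|cluster D W z|) + costBranch n)); last first.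
  by move=> y /andP[Wy _]; rewrite cardW.
apply: time_bound_rec => //.
- by rewrite card_gt0.
- move=> y /andP[Wy _]; rewrite subset_leq_card ?cluster_sub // andbT.
  by apply/card_gt0P; exists y; apply: cluster_self.
(* No cluster has more than n vertices, so the same H = 41 n is large enough for every W. *)
- apply: (@sum_branches c c_large _ _ _ (41 * n)).
  + by rewrite muln_gt0 /=; apply/card_gt0P; exists x.
  + by move=> y _; apply/card_gt0P; exists y; apply: cluster_self.
  + by move=> y _; rewrite leq_mul2l max_card.
  + by rewrite -weightE.
set P := #|_|; have : costBranch n * P <= costBranch n * n.
  by rewrite leq_mul2l max_card orbT.
by move: leA; rewrite /costOpt; lia.
Qed.

Lemma run_solver (c : rat) :
  (16 / 11 <= c)%R ->
  exists2 t, run solver (tree_of_digraph D) (tree_of_nat (opt D [set: V])) t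
    & t <= costMain n + time_bound c (costOpt n) n.
Proof.
move=> c_large; have opt_run := computes_opt [set: V] c_large (leqnn _).
rewrite cardsT -/n in opt_run.
have ones : computes fOnes (rows (enum V)) (set_tree [set: V]) (costBits n).
  rewrite (@set_treeE _ (fun=> true)); last by move=> v; rewrite inE.
  by rewrite /costBits -size_enum; apply: computes_ones.
have units : computes fUnits (rows (enum V)) (tree_of_nat (41 * n)) (200 * n.+1).
  by rewrite -!size_enum; apply: computes_units.
have hots : computes fOnehots (rows (enum V)) (singletons (enum V))
    (100 * n.+1 * n.+1).
  have -> : singletons (enum V)
      = tree_of_seq [seq bits (eq_op^~ x) (enum V) | x <- enum V].
    congr tree_of_seq; apply: eq_map => x; apply: set_treeE => v.
    by rewrite inE.
  by rewrite -!size_enum; apply: computes_onehots; apply: enum_uniq.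
(* [rows (enum V)] is the encoded input by conversion. *)
suff : computes fMain (rows (enum V)) (tree_of_nat (opt D [set: V]))
    (costMain n + time_bound c (costOpt n) n) by [].
by run_body; rewrite /costMain; lia.
Qed.

End Machine.

(** * Polynomial bounds on the local costs *)

Section PolynomialCosts.

Import Order.TTheory GRing.Theory Num.Theory.
Local Open Scope ring_scope.

Definition polynomial_cost (f : nat -> nat) :=
  exists p : {poly rat}, forall n, (f n)%:R = p.[n%:R].

Lemma polynomial_cost_const k : polynomial_cost (fun=> k).
Proof. by exists k%:R%:P => n; rewrite hornerC. Qed.

Lemma polynomial_cost_id : polynomial_cost id.
Proof. by exists 'X => n; rewrite hornerX. Qed.

Lemma polynomial_cost_add f g :
  polynomial_cost f -> polynomial_cost g -> polynomial_cost (fun n => f n + g n)%N.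
Proof.
by case=> p fp [q gq]; exists (p + q) => n; rewrite natrD fp gq hornerD.
Qed.

Lemma polynomial_cost_mul f g :
  polynomial_cost f -> polynomial_cost g -> polynomial_cost (fun n => f n * g n)%N.
Proof.
by case=> p fp [q gq]; exists (p * q) => n; rewrite natrM fp gq hornerM.
Qed.

Lemma polynomial_cost_succ f :
  polynomial_cost f -> polynomial_cost (fun n => (f n).+1).
Proof.
by case=> p fp; exists (p + 1%:P) => n; rewrite -natr1 fp hornerD hornerC.
Qed.

Ltac polynomial_cost :=
  repeat first [ exact: polynomial_cost_const | exact: polynomial_cost_id
    | apply: polynomial_cost_add | apply: polynomial_cost_mul
    | apply: polynomial_cost_succ ].

Lemma polynomial_costMain : polynomial_cost costMain.
Proof. by rewrite /costMain /costBits; polynomial_cost. Qed.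

Lemma polynomial_costOpt : polynomial_cost costOpt.
Proof.
rewrite /costOpt /costBranch /costChoose /costWeight /costSelect /costClusters.
by rewrite /costDiv /costBasin /costNbrs /costBits; polynomial_cost.
Qed.

(** As c^n >= 1, the polynomial cost of the preprocessing is absorbed into the polynomial factor of
    c^n. *)
Lemma Ostar_total_cost (c : rat) : 16 / 11 <= c ->
  Ostar c (fun n => costMain n + time_bound c (costOpt n) n)%N.
Proof.
move=> c_large.
have [p defp] := polynomial_cost_add polynomial_costMain
  (polynomial_cost_mul polynomial_costOpt (polynomial_cost_succ polynomial_cost_id)).
exists p => n; rewrite -defp natrD [in leRHS]natrD [in leRHS]natrM mulrDl lerD //;
  last exact: (time_bound_le c_large).
by rewrite ler_peMr ?ler0n // exprn_ege1 // (c_ge1 c_large).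
Qed.

End PolynomialCosts.

Theorem theorem3 :
  exists (P : program) (T : nat -> nat),
    solves_kfvd_in_time P T /\ Ostar 1.4549%Q T.
Proof.
have c_large : (16 / 11 <= 1.4549%Q :> rat)%R by vm_compute.
exists solver, (fun n => costMain n + time_bound 1.4549%Q (costOpt n) n).
split; last exact: Ostar_total_cost c_large.
move=> V D; have [t run_t le_t] := run_solver D c_large.
by exists (opt D [set: V]), t; split; first exact: kfvd_optimum_opt.
Qed.
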